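(* Let $\mathcal{X}^1,\mathcal{X}^2,\mathcal{U}^1,\mathcal{U}^2$ be complex Hilbert spaces, and let $L,K,\mathcal{Z}^1,\mathcal{Z}^2,\gamma^1,\gamma^2,\beta^1,\beta^2$, $J$ and $G$ be as described in the context (in particular satisfying the abstract Green's identity stated there). Assume furthermore that: (1) $\gamma^i\in\mathcal{L}(\mathcal{Z}^i,\mathcal{U}^i)$ is onto, $i=1,2$; (2) $\mathcal{X}^i_1 := \ker\gamma^i$ is dense in $\mathcal{X}^i$, $i=1,2$; (3) either $\mathcal{X}^1_0 := \ker\gamma^1\cap\ker\beta^1$ is dense in $\mathcal{X}^1$ and $\beta^1$ restricted to $\mathcal{X}^1_1$ is onto $(\mathcal{U}^2)'$, or $\mathcal{X}^2_0 := \ker\gamma^2\cap\ker\beta^2$ is dense in $\mathcal{X}^2$ and $\beta^2$ restricted to $\mathcal{X}^2_1$ is onto $(\mathcal{U}^1)'$. Let $A := J|_{\mathcal{X}_1}$ with domain $\mathcal{X}_1 := \mathcal{X}^1_1\times\mathcal{X}^2_1$, let $\mathcal{X}_{-1}$ be the completion of $\mathcal{X}$ endowed with the norm $\|(I-A)^{-1}\cdot\|_{\mathcal{X}}$, let $A|_{\mathcal{X}}$ denote the continuous extension of $A$ to $\mathcal{X}$, with values in $\mathcal{X}_{-1}$, and let $\mathcal{X}^i_{-1}$ be the projection of $\mathcal{X}_{-1}$ on the $i$-th component, $i=1,2$. Then there exist a unique control operator $B^1\in\mathcal{L}(\mathcal{U}^1,\mathcal{X}^2_{-1})$ associated to $\gamma^1$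 and a unique control operator $B^2\in\mathcal{L}(\mathcal{U}^2,\mathcal{X}^1_{-1})$ associated to $\gamma^2$ such that the graph of $\mathcal{J}\in\mathcal{L}(\mathcal{E},\mathcal{F})$, $\mathcal{F} := \mathcal{E}'$, defined by $$\mathcal{J} := \begin{bmatrix} A|_{\mathcal{X}} & \begin{bmatrix} 0 & B^2 \\ B^1 & 0\end{bmatrix} \\ -\begin{bmatrix} 0 & \beta^2 \\ \beta^1 & 0\end{bmatrix} & \begin{bmatrix} 0&0 \\ 0&0\end{bmatrix}\end{bmatrix},$$ $$\mathcal{E} := \left\{\begin{pmatrix} e^1 \\ e^2 \\ u^1 \\ u^2\end{pmatrix}\in\mathcal{X}^1\times\mathcal{X}^2\times\mathcal{U}^1\times\mathcal{U}^2 \;\middle|\; A|_{\mathcal{X}}\begin{pmatrix} e^1 \\ e^2\end{pmatrix} + \begin{bmatrix} 0&B^2 \\ B^1&0\end{bmatrix}\begin{pmatrix} u^1 \\ u^2\end{pmatrix}\in\mathcal{X}^1\times\mathcal{X}^2\right\},$$ is a Stokes-Dirac structure $\mathcal{D}$ in the bond space $\mathcal{B} := \mathcal{F}\times\mathcal{E}$.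
   Context: Standing setting: - $\mathcal{X}^1$ and $\mathcal{X}^2$ are complex Hilbert spaces, identified with their respective duals; $\mathcal{X} := \mathcal{X}^1\times\mathcal{X}^2$. - $L$ is a closed and densely defined operator from $\mathcal{X}^1$ into $\mathcal{X}^2$ with domain $\mathcal{Z}^1$; $K$ is a closed and densely defined operator from $\mathcal{X}^2$ into $\mathcal{X}^1$ with domain $\mathcal{Z}^2$. The domains $\mathcal{Z}^1$, $\mathcal{Z}^2$ are Hilbert spaces for the respective graph norms, so that $L\in\mathcal{L}(\mathcal{Z}^1,\mathcal{X}^2)$ and $K\in\mathcal{L}(\mathcal{Z}^2,\mathcal{X}^1)$. - $J := \begin{bmatrix} 0 & -K \\ L & 0\end{bmatrix}$, defined on $\mathcal{Z}^1\times\mathcal{Z}^2$ with values in $\mathcal{X}$. - $\mathcal{U}^1,\mathcal{U}^2$ are complex Hilbert spaces with topological duals $(\mathcal{U}^1)',(\mathcal{U}^2)'$, $\mathcal{U} := \mathcal{U}^1\times\mathcal{U}^2$; $\gamma^i\in\mathcal{L}(\mathcal{Z}^i,\mathcal{U}^i)$ for $i=1,2$, and $G := \begin{bmatrix}\gamma^1&0 \\ 0&\gamma^2\end{bmatrix}\in\mathcal{L}(\mathcal{Z}^1\times\mathcal{Z}^2,\mathcal{U}^1\times\mathcal{U}^2)$; $\beta^1\in\mathcal{L}(\mathcal{Z}^1,(\mathcal{U}^2)')$ and $\beta^2\in\mathcal{L}(\mathcal{Z}^2,(\mathcal{U}^1)')$. - Abstract Green's identity: for all $e^1\in\mathcal{Z}^1$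 and $e^2\in\mathcal{Z}^2$, $$(Le^1,e^2)_{\mathcal{X}^2} = (e^1,Ke^2)_{\mathcal{X}^1} + \langle\gamma^1e^1,\beta^2e^2\rangle_{\mathcal{U}^1,(\mathcal{U}^1)'} + \langle\beta^1e^1,\gamma^2e^2\rangle_{(\mathcal{U}^2)',\mathcal{U}^2}.$$ Conventions: inner products and duality brackets are antilinear in the first variable and linear in the second; for a complex Hilbert space $\mathcal{V}$, $\langle f,v\rangle_{\mathcal{V}',\mathcal{V}}:=f(v)$, with the scalar multiplication of $\mathcal{V}'$ given by $(\lambda f)(v)=\overline{\lambda}f(v)$, and $\langle v,f\rangle_{\mathcal{V},\mathcal{V}'} := \overline{\langle f,v\rangle_{\mathcal{V}',\mathcal{V}}}$. Control operators ''associated to'' $\gamma^1,\gamma^2$: $B := \begin{bmatrix}0&B^2 \\ B^1&0\end{bmatrix}\in\mathcal{L}(\mathcal{U},\mathcal{X}_{-1})$ is the control operator of the boundary control system $(J,G)$, i.e. $Jz = A|_{\mathcal{X}}z + BGz$ in $\mathcal{X}_{-1}$ for all $z\in\mathcal{Z}^1\times\mathcal{Z}^2$, so that $B^1$ is constructed from $\gamma^1$ and $B^2$ from $\gamma^2$. The space $\mathcal{E}$ carries the graph norm $\|(e,u)\|_{\mathcal{E}}^2 = \|e\|_{\mathcal{X}}^2+\|u\|_{\mathcal{U}}^2+\|A|_{\mathcal{X}}e+Bu\|_{\mathcal{X}}^2$; the map $z\mapsto(z,Gz)$ is a bounded bijection from $\mathcal{Z}^1\times\mathcal{Z}^2$ onto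 $\mathcal{E}$, so that $\beta^1e^1$, $\beta^2e^2$ make sense for elements of $\mathcal{E}$. An element $(x,v)\in\mathcal{X}\times\mathcal{U}'$ is regarded as an element of $\mathcal{F}=\mathcal{E}'$ through $\langle(x,v),(e,u)\rangle_{\mathcal{F},\mathcal{E}} := (x,e)_{\mathcal{X}}+\langle v,u\rangle_{\mathcal{U}',\mathcal{U}}$. Bond space and Stokes-Dirac structure: $\mathcal{B} := \mathcal{F}\times\mathcal{E}$ is endowed with $$\left\langle\left\langle \begin{pmatrix} f^1 \\ e^1\end{pmatrix},\begin{pmatrix} f^2 \\ e^2\end{pmatrix}\right\rangle\right\rangle_{\mathcal{B}} := \overline{\langle f^1,e^2\rangle_{\mathcal{F},\mathcal{E}}} + \langle f^2,e^1\rangle_{\mathcal{F},\mathcal{E}}$$ (superscripts here label elements of $\mathcal{F}$ and $\mathcal{E}$). For a subspace $\mathcal{D}\subset\mathcal{B}$, $\mathcal{D}^{[\perp]} := \{b^1\in\mathcal{B} \mid \langle\langle b^1,b^2\rangle\rangle_{\mathcal{B}}=0 \text{ for all } b^2\in\mathcal{D}\}$, and $\mathcal{D}$ is a Stokes-Dirac structure if and only if $\mathcal{D}^{[\perp]}=\mathcal{D}$. The graph of $\mathcal{J}$ is $\{(\mathcal{J}e,e)\in\mathcal{F}\times\mathcal{E} \mid e\in\mathcal{E}\}$.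
   Formalization: The formal theorem takes the space X_{-1} as given, which presupposes that I − A is onto X; this does not follow from (1)–(3) (e.g. L = d/dx, K = −d/dx on H^1_0(0,1) with U^1 = U^2 = 0), and without it the norm defining X_{-1} is undefined. *)

(* Defs.v *)
(* The complex field is R[i], for an arbitrary R : realType. *)
From HB Require Import structures.
From mathcomp Require Import all_boot all_order all_algebra.
From mathcomp.real_closed Require Import complex.
From mathcomp Require Import all_classical all_reals all_analysis.

Set Implicit Arguments.
Unset Strict Implicit.
Unset Printing Implicit Defensive.

Import Order.TTheory GRing.Theory Num.Theory.
Import numFieldNormedType.Exports.

Local Open Scope classical_set_scope.
Local Open Scope ring_scope.

(* The inner product is antilinear in its first argument and linear in its
   second one, contrary to the forms of sesquilinear.v. *)
HB.mixin Record hasInner (R : realType) V & CompleteNormedModule R[i] V := {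
  inner : V -> V -> R[i];
  inner_scalar : forall x, scalar (inner x);
  innerC : forall x y, inner y x = (inner x y)^*;
  inner_norm : forall x, inner x x = `|x| ^+ 2 }.

#[short(type="hilbertType")]
HB.structure Definition Hilbert (R : realType) :=
  { V of hasInner R V & CompleteNormedModule R[i] V }.

Section Dual.
Variables (R : realType) (V : normedModType R[i]).

Record dual := Dual {
  dual_fun :> V -> R[i];
  dual_scalar : scalar dual_fun;
  dual_continuous : continuous (dual_fun : V -> R[i]^o) }.

HB.instance Definition _ := gen_eqMixin dual.
HB.instance Definition _ := gen_choiceMixin dual.
HB.instance Definition _ (f : dual) :=
  GRing.isLinear.Build R[i] V R[i] *%R (dual_fun f) (dual_scalar f).

Implicit Types f g : dual.

Lemma dualP f g : (forall v, f v = g v) -> f = g.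
Proof.
case: f => f fl fc; case: g => g gl gc /= /funext fg.
by subst g; congr Dual; exact: Prop_irrelevance.
Qed.

Lemma scalar_bounded_continuous (h : V -> R[i]) : scalar h ->
  (exists2 M, 0 <= M & forall v, `|h v| <= M * `|v|) ->
  continuous (h : V -> R[i]^o).
Proof.
move=> hl [M M0 hM].
pose g : {linear V -> R[i]^o} :=
  HB.pack (h : V -> R[i]^o) (GRing.isLinear.Build R[i] V R[i]^o *:%R h hl).
apply: (@bounded_linear_continuous _ _ _ g); apply/linear_boundedP.
exists M; split; first exact: ger0_real.
move=> r Mr v; apply: (le_trans (hM v)).
by rewrite ler_wpM2r// ltW.
Qed.

Lemma dual_bounded f : exists2 M, 0 <= M & forall v, `|f v| <= M * `|v|.
Proof.
pose g : {linear V -> R[i]^o} := HB.pack (f : V -> R[i]^o)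
  (GRing.isLinear.Build R[i] V R[i]^o *:%R f (@dual_scalar f)).
have /linear_boundedP/pinfty_ex_gt0[M M0 gM] :
    bounded_near (g : V -> R[i]^o) (nbhs (0 : V)).
  by apply: (continuous_linear_bounded 0); apply: (@dual_continuous f).
by exists M => //; exact: ltW.
Qed.

Let fun0 : V -> R[i] := fun=> 0.
Let funN f : V -> R[i] := fun v => - f v.
Let funD f g : V -> R[i] := fun v => f v + g v.
(* The duality bracket <f, v> = f v is antilinear in f. *)
Let funZ (a : R[i]) f : V -> R[i] := fun v => a^* * f v.

Let scalar0 : scalar fun0.
Proof. by move=> a v w; rewrite /fun0 mulr0 addr0. Qed.
Let scalarN f : scalar (funN f).
Proof. by move=> a v w; rewrite /funN linearP opprD mulrN. Qed.
Let scalarD f g : scalar (funD f g).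
Proof. by move=> a v w; rewrite /funD !linearP mulrDr addrACA. Qed.
Let scalarZ a f : scalar (funZ a f).
Proof. by move=> b v w; rewrite /funZ linearP mulrDr mulrCA. Qed.

Let continuous0 : continuous (fun0 : V -> R[i]^o).
Proof.
apply: scalar_bounded_continuous; first exact: scalar0.
by exists 0 => // v; rewrite normr0 mul0r.
Qed.
Let continuousN f : continuous (funN f : V -> R[i]^o).
Proof.
apply: scalar_bounded_continuous; first exact: scalarN.
have [M M0 fM] := dual_bounded f.
by exists M => // v; rewrite normrN.
Qed.
Let continuousD f g : continuous (funD f g : V -> R[i]^o).
Proof.
apply: scalar_bounded_continuous; first exact: scalarD.
have [M M0 fM] := dual_bounded f; have [N N0 gN] := dual_bounded g.
exists (M + N); first exact: addr_ge0.
by move=> v; rewrite mulrDl; apply: (le_trans (ler_normD _ _)); exact: lerD.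
Qed.
Let continuousZ a f : continuous (funZ a f : V -> R[i]^o).
Proof.
apply: scalar_bounded_continuous; first exact: scalarZ.
have [M M0 fM] := dual_bounded f.
exists (`|a| * M); first exact: mulr_ge0.
by move=> v; rewrite normrM norm_conjC -mulrA ler_wpM2l.
Qed.

Definition dual0 := Dual scalar0 continuous0.
Definition dualN f := Dual (scalarN f) (@continuousN f).
Definition dualD f g := Dual (scalarD f g) (@continuousD f g).
Definition dualZ a f := Dual (scalarZ a f) (@continuousZ a f).

Let dualDA : associative dualD.
Proof. by move=> f g h; apply: dualP => v /=; rewrite /funD /= addrA. Qed.
Let dualDC : commutative dualD.
Proof. by move=> f g; apply: dualP => v /=; rewrite /funD /= addrC. Qed.
Let dual0D : left_id dual0 dualD.
Proof. by move=> f; apply: dualP => v /=; rewrite /funD /= add0r. Qed.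
Let dualND : left_inverse dual0 dualN dualD.
Proof. by move=> f; apply: dualP => v /=; rewrite /funD /= addNr. Qed.

HB.instance Definition _ :=
  GRing.isZmodule.Build dual dualDA dualDC dual0D dualND.

Let dualZA a b f : dualZ a (dualZ b f) = dualZ (a * b) f.
Proof. by apply: dualP => v /=; rewrite /funZ /= rmorphM mulrA. Qed.
Let dual1Z : left_id 1 dualZ.
Proof. by move=> f; apply: dualP => v /=; rewrite /funZ /= rmorph1 mul1r. Qed.
Let dualZDr : right_distributive dualZ +%R.
Proof. by move=> a f g; apply: dualP => v /=; rewrite /funZ /= mulrDr. Qed.
Let dualZDl f : {morph dualZ^~ f : a b / a + b}.
Proof.
by move=> a b; apply: dualP => v /=; rewrite /funZ /= rmorphD mulrDl.
Qed.

HB.instance Definition _ := GRing.Zmodule_isLmodule.Build R[i] dual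
  dualZA dual1Z dualZDr dualZDl.

Lemma dual0E v : (0 : dual) v = 0. Proof. by []. Qed.
Lemma dualNE f v : (- f) v = - f v. Proof. by []. Qed.
Lemma dualDE f g v : (f + g) v = f v + g v. Proof. by []. Qed.
Lemma dualZE a f v : (a *: f) v = a^* * f v. Proof. by []. Qed.

Definition dual_norm f : R[i] :=
  (sup [set complex.Re `|f v| | v in [set v : V | `|v| <= 1]])%:C%C.

Let dual_norm_has_sup f :
  has_sup [set complex.Re `|f v| | v in [set v : V | `|v| <= 1]].
Proof.
split; first by exists (complex.Re `|f 0|), 0 => //=; rewrite normr0.
have [M M0 fM] := dual_bounded f.
exists (complex.Re M) => _ [v /= v1 <-].
have : `|f v| <= M by rewrite (le_trans (fM v))// ler_piMr.
by rewrite lecE => /andP[].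
Qed.

Lemma ler_dual_norm f v : `|f v| <= dual_norm f * `|v|.
Proof.
have [->|v0] := eqVneq v 0; first by rewrite linear0 !normr0 mulr0.
rewrite -ler_pdivrMr ?normr_gt0//.
have -> : `|f v| / `|v| = `|f (`|v|^-1 *: v)|.
  by rewrite linearZ/= normrM normfV normr_id mulrC.
rewrite -(RRe_real (normr_real _)) lecR.
apply: ub_le_sup; first by case: (dual_norm_has_sup f).
exists (`|v|^-1 *: v) => //=.
by rewrite normrZ normfV normr_id mulVf// normr_eq0.
Qed.

Lemma dual_norm_ler f M :
  0 <= M -> (forall v, `|f v| <= M * `|v|) -> dual_norm f <= M.
Proof.
move=> M0 fM; rewrite -(RRe_real (ger0_real M0)) lecR.
apply: ge_sup; first by case: (dual_norm_has_sup f).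
move=> _ [v /= v1 <-].
have : `|f v| <= M by rewrite (le_trans (fM v))// ler_piMr.
by rewrite lecE => /andP[].
Qed.

Lemma dual_norm_ge0 f : 0 <= dual_norm f.
Proof.
rewrite ler0c; apply: le_trans (_ : complex.Re `|f 0| <= _); last first.
  apply: ub_le_sup; first by case: (dual_norm_has_sup f).
  by exists 0 => //=; rewrite normr0.
by rewrite linear0 normr0.
Qed.

Let dual_normD f g : dual_norm (f + g) <= dual_norm f + dual_norm g.
Proof.
apply: dual_norm_ler; first by rewrite addr_ge0 ?dual_norm_ge0.
move=> v; rewrite mulrDl; apply: (le_trans (ler_normD _ _)).
by apply: lerD; exact: ler_dual_norm.
Qed.

Let dual_normZ_le a f : dual_norm (a *: f) <= `|a| * dual_norm f.
Proof.
apply: dual_norm_ler; first by rewrite mulr_ge0 ?dual_norm_ge0.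
move=> v; rewrite dualZE normrM norm_conjC -mulrA ler_wpM2l//.
exact: ler_dual_norm.
Qed.

Let dual_normZ a f : dual_norm (a *: f) = `|a| * dual_norm f.
Proof.
apply/eqP; rewrite eq_le dual_normZ_le /=.
have [->|a0] := eqVneq a 0; first by rewrite normr0 mul0r dual_norm_ge0.
rewrite -ler_pdivlMl ?normr_gt0// -normfV.
by apply: le_trans (dual_normZ_le _ _); rewrite scalerA mulVf// scale1r.
Qed.

Let dual_norm0_eq0 f : dual_norm f = 0 -> f = 0.
Proof.
move=> f0; apply: dualP => v; apply/eqP; rewrite -normr_le0.
by rewrite (le_trans (ler_dual_norm f v))// f0 mul0r.
Qed.

HB.instance Definition _ := Lmodule_isNormed.Build R[i] dual
  dual_normD dual_normZ dual_norm0_eq0.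

End Dual.

Section InnerTheory.
Variables (R : realType) (V : hilbertType R).
Implicit Types x y : V.

HB.instance Definition _ x :=
  GRing.isLinear.Build R[i] V R[i] *%R (inner x) (inner_scalar x).

Lemma innerDl x y z : inner (x + y) z = inner x z + inner y z.
Proof. by rewrite innerC linearD rmorphD (innerC z x) (innerC z y). Qed.

Lemma innerZl a x y : inner (a *: x) y = a^* * inner x y.
Proof. by rewrite innerC linearZ rmorphM (innerC y x). Qed.

Lemma CauchySchwarz_inner x y : `|inner x y| <= `|x| * `|y|.
Proof.
have [->|x0] := eqVneq x 0.
  by rewrite innerC linear0 conjC0 !normr0 mul0r.
have nx0 : 0 < `|x| ^+ 2 by rewrite exprn_gt0// normr_gt0.
have [a aE] : exists a, a * `|x| ^+ 2 = inner x y.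
  by exists (inner x y / `|x| ^+ 2); rewrite divfK// gt_eqF.
have : 0 <= inner (y - a *: x) (y - a *: x) by rewrite inner_norm exprn_ge0.
rewrite -scaleNr innerDl innerZl !linearD !linearZ/= !inner_norm.
rewrite [- a * (_ ^+ 2)]mulNr aE subrr mulr0 addr0 mulNr subr_ge0.
rewrite -(ler_pM2l nx0) mulrA [_ * a]mulrC aE (innerC x y) -normCK -exprMn.
by rewrite ler_sqr ?nnegrE ?mulr_ge0.
Qed.

End InnerTheory.

Section PairNorm.
Variable R : realType.
Implicit Types a b c d : R[i].

Definition l2norm a b : R[i] := sqrtC (`|a| ^+ 2 + `|b| ^+ 2).

Lemma l2norm_ge0 a b : 0 <= l2norm a b.
Proof. by rewrite sqrtC_ge0 addr_ge0// exprn_ge0. Qed.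

Lemma ler_l2norml a b : `|a| <= l2norm a b.
Proof.
rewrite -[leLHS]sqrCK// ler_sqrtC ?nnegrE ?addr_ge0 ?exprn_ge0//.
by rewrite lerDl exprn_ge0.
Qed.

Lemma ler_l2normr a b : `|b| <= l2norm a b.
Proof. by rewrite /l2norm addrC; exact: ler_l2norml. Qed.

Lemma l2norm_eq0 a b : l2norm a b = 0 -> a = 0 /\ b = 0.
Proof.
move=> ab0; split; apply/eqP; rewrite -normr_le0 -ab0.
  exact: ler_l2norml.
exact: ler_l2normr.
Qed.

Lemma l2normM c a b : l2norm (c * a) (c * b) = `|c| * l2norm a b.
Proof.
rewrite /l2norm !normrM !exprMn -mulrDr sqrtCM ?nnegrE ?addr_ge0 ?exprn_ge0//.
by rewrite sqrCK.
Qed.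

Lemma l2normD a b c d :
  l2norm (`|a| + `|c|) (`|b| + `|d|) <= l2norm a b + l2norm c d.
Proof.
have E x y : l2norm x y = `| `|x| + 'i * `|y| |.
  by rewrite normC_rect ?normr_real.
rewrite !E; apply: le_trans (ler_normD _ _).
by rewrite !(ger0_norm (addr_ge0 (normr_ge0 _) (normr_ge0 _))) mulrDr addrACA.
Qed.

Lemma ler_l2norm a b c d :
  `|a| <= `|c| -> `|b| <= `|d| -> l2norm a b <= l2norm c d.
Proof.
move=> ac bd; rewrite ler_sqrtC ?nnegrE ?addr_ge0 ?exprn_ge0//.
by apply: lerD; rewrite ler_sqr ?nnegrE.
Qed.

End PairNorm.

(* The Hilbert norm of a product; the norm of the normedModType V * W is the
   equivalent max norm. *)
Definition pair_norm (R : realType) (V W : normedModType R[i]) (p : V * W) :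
    R[i] :=
  sqrtC (`|p.1| ^+ 2 + `|p.2| ^+ 2).

Definition pair_inner (R : realType) (V W : hilbertType R) (p q : V * W) :
    R[i] :=
  inner p.1 q.1 + inner p.2 q.2.

Section PairNormTheory.
Variables (R : realType) (V W : normedModType R[i]).
Implicit Types p q : V * W.

Lemma pair_normE p : pair_norm p = l2norm `|p.1| `|p.2|.
Proof. by rewrite /l2norm !normr_id. Qed.

Lemma pair_norm_ge0 p : 0 <= pair_norm p.
Proof. by rewrite pair_normE l2norm_ge0. Qed.

Lemma pair_normD p q : pair_norm (p + q) <= pair_norm p + pair_norm q.
Proof.
rewrite !pair_normE; apply: le_trans (l2normD _ _ _ _).
by apply: ler_l2norm;
  rewrite !normr_id [leRHS]ger0_norm ?addr_ge0//; exact: ler_normD.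
Qed.

Lemma pair_normZ a p : pair_norm (a *: p) = `|a| * pair_norm p.
Proof. by rewrite !pair_normE /= !normrZ l2normM normr_id. Qed.

Lemma pair_norm_eq0 p : pair_norm p = 0 -> p = 0.
Proof.
case: p => x y; rewrite pair_normE => /l2norm_eq0[/= /eqP + /eqP].
by rewrite !normr_eq0 => /eqP -> /eqP ->.
Qed.

Lemma ler_pair_norml p : `|p.1| <= pair_norm p.
Proof. by rewrite pair_normE -[leLHS]normr_id ler_l2norml. Qed.

Lemma ler_pair_normr p : `|p.2| <= pair_norm p.
Proof. by rewrite pair_normE -[leLHS]normr_id ler_l2normr. Qed.

End PairNormTheory.

Definition linear_on (R : realType) (V W : lmodType R[i]) (D : set V)
    (f : V -> W) :=
  forall a x y, D x -> D y -> f (a *: x + y) = a *: f x + f y.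

(* Unbounded operators. The underlying function is total, but its values
   outside the domain are irrelevant. *)
Record operator (R : realType) (V W : lmodType R[i]) := Operator {
  dom : set V;
  operator_fun :> V -> W;
  dom0 : dom 0;
  dom_linear : forall a x y, dom x -> dom y -> dom (a *: x + y);
  operator_linear : linear_on dom operator_fun }.

Section Operators.
Variables (R : realType) (V W : normedModType R[i]) (T : operator V W).

Definition closed_operator :=
  closed [set p : V * W | dom T p.1 /\ p.2 = T p.1].

Definition densely_defined := dense (dom T).

Definition graph_norm (x : V) : R[i] := pair_norm (x, T x).

(* The bounded linear maps from dom T, with the graph norm of T, to Y. *)
Record graph_bounded (Y : normedModType R[i]) := GraphBounded {
  graph_bounded_fun :> V -> Y;
  graph_bounded_linear : linear_on (dom T) graph_bounded_fun;
  graph_boundedP : exists M : R[i],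
    forall x, dom T x -> `|graph_bounded_fun x| <= M * graph_norm x }.

Definition kernel_on (Y : normedModType R[i]) (f : graph_bounded Y) : set V :=
  [set x | dom T x /\ f x = 0].

End Operators.

(* (I - T)^-1 x, with the default value 0 when x is not in the range of
   I - T. *)
Definition resolvent1 (R : realType) (V : lmodType R[i]) (T : operator V V)
    (x : V) : V :=
  xget 0 [set z | dom T z /\ z - T z = x].

Record completion (R : realType) (V : lmodType R[i]) (N : V -> R[i]) :=
  Completion {
    completion_space :> completeNormedModType R[i];
    completion_inj : {linear V -> completion_space};
    completion_norm0 : forall x, N x = 0 -> x = 0;
    completion_isometry : forall x, `|completion_inj x| = N x;
    completion_dense : dense (range completion_inj) }.

Section Blocks.
Variables (R : realType) (X1 X2 U1 U2 : hilbertType R).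
Variables (L : operator X1 X2) (K : operator X2 X1).
Variables (gamma1 : graph_bounded L U1) (gamma2 : graph_bounded K U2).

Let block_fun (z : X1 * X2) : X1 * X2 := (- K z.2, L z.1).

Let Jdom : set (X1 * X2) := [set z | dom L z.1 /\ dom K z.2].

Let Jdom0 : Jdom 0.
Proof. by split; exact: dom0. Qed.

Let Jdom_linear a x y : Jdom x -> Jdom y -> Jdom (a *: x + y).
Proof. by move=> [? ?] [? ?]; split; exact: dom_linear. Qed.

Let J_linear : linear_on Jdom block_fun.
Proof.
move=> a [x1 x2] [y1 y2] [/= Lx Kx] [/= Ly Ky].
rewrite /block_fun /= !operator_linear//.
by congr pair; rewrite opprD -scalerN.
Qed.

Definition J_operator : operator (X1 * X2)%type (X1 * X2)%type :=
  Operator Jdom0 Jdom_linear J_linear.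

Let Adom : set (X1 * X2) :=
  [set z | kernel_on gamma1 z.1 /\ kernel_on gamma2 z.2].

Let Adom0 : Adom 0.
Proof.
have L0 := dom0 L; have K0 := dom0 K.
split; split=> //=; [have := graph_bounded_linear gamma1 (-1) L0 L0
                    |have := graph_bounded_linear gamma2 (-1) K0 K0];
by rewrite scaler0 addr0 => ->; rewrite scaleN1r addNr.
Qed.

Let Adom_linear a x y : Adom x -> Adom y -> Adom (a *: x + y).
Proof.
move=> [[? x1] [? x2]] [[? y1] [? y2]]; split; split=> /=;
  do ?exact: dom_linear;
by rewrite graph_bounded_linear// ?x1 ?x2 ?y1 ?y2 scaler0 addr0.
Qed.

Let A_linear : linear_on Adom block_fun.
Proof. by move=> a x y [[? _] [? _]] [[? _] [? _]]; exact: J_linear. Qed.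

Definition A_operator : operator (X1 * X2)%type (X1 * X2)%type :=
  Operator Adom0 Adom_linear A_linear.

Definition G_block (z : X1 * X2) : U1 * U2 := (gamma1 z.1, gamma2 z.2).

(* X_{-1}. Since completion_norm0 requires |(I - A)^-1 x| to be a norm on the
   whole of X, this type is empty unless I - A maps dom A onto X. *)
Definition extrapolation :=
  completion (fun x : X1 * X2 => pair_norm (resolvent1 A_operator x)).

Variable Y : extrapolation.
Let inj : {linear (X1 * X2)%type -> Y} := completion_inj Y.

Definition is_extension (AX : {linear (X1 * X2)%type -> Y}) :=
  continuous AX /\
  forall z, dom A_operator z -> AX z = inj (A_operator z).

(* The projection of X_{-1} on a component: the range of the continuous
   extension P of the projection p of X on this component. *)
Definition component (p : X1 * X2 -> X1 * X2) : set Y :=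
  [set y | exists P : Y -> Y,
     [/\ continuous P, forall x, P (inj x) = inj (p x) & range P y]].
Definition component1 : set Y := component (fun x => (x.1, 0)).
Definition component2 : set Y := component (fun x => (0, x.2)).

Section Block_control.
Variables (B1 : {linear U1 -> Y}) (B2 : {linear U2 -> Y}).

(* [0 B2; B1 0], the components of X_{-1} being subspaces of X_{-1}. *)
Definition B_block (u : U1 * U2) : Y := B2 u.2 + B1 u.1.

Let B_block_linear : linear B_block.
Proof. by move=> a u v; rewrite /B_block !linearP scalerDr addrACA. Qed.

HB.instance Definition _ := GRing.isLinear.Build R[i] (U1 * U2)%type Y *:%R
  B_block B_block_linear.

End Block_control.

Definition control_operators (AX : {linear (X1 * X2)%type -> Y})
    (B1 : {linear U1 -> Y}) (B2 : {linear U2 -> Y}) :=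
  [/\ continuous B1 /\ range B1 `<=` component2,
      continuous B2 /\ range B2 `<=` component1 &
      forall z, dom J_operator z ->
        inj (J_operator z) = AX z + B_block B1 B2 (G_block z)].

Section Effort.
Variables (AX : {linear (X1 * X2)%type -> Y}).
Variables (B : {linear (U1 * U2)%type -> Y}).

Definition effort_set : set ((X1 * X2) * (U1 * U2)) :=
  [set w | range inj (AX w.1 + B w.2)].

Definition effort_pred : {pred ((X1 * X2) * (U1 * U2))} :=
  fun w => w \in effort_set.

Let effort_submod : submod_closed effort_pred.
Proof.
split; first by rewrite inE; exists 0 => //=; rewrite !linear0 addr0.
move=> a v w; rewrite !inE => -[x _ xE] [y _ yE].
exists (a *: x + y) => //=.
by rewrite linearP xE yE !linearP scalerDr addrACA.
Qed.

HB.instance Definition _ := GRing.isSubmodClosed.Build R[i]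
  ((X1 * X2) * (U1 * U2))%type effort_pred effort_submod.

Record effort := Effort {
  effort_val :> (X1 * X2) * (U1 * U2);
  effortP : effort_val \in effort_pred }.

HB.instance Definition _ := [isSub for effort_val].
HB.instance Definition _ := [Choice of effort by <:].
HB.instance Definition _ := [SubChoice_isSubLmodule of effort by <:].

(* The element of X embedded as AX e + B u in X_{-1}. *)
Definition effort_drift (w : effort) : X1 * X2 :=
  xget 0 [set x | inj x = AX (effort_val w).1 + B (effort_val w).2].

Lemma completion_inj_inj : injective inj.
Proof.
move=> x y xy; apply/eqP; rewrite -subr_eq0; apply/eqP.
apply: (@completion_norm0 _ _ _ Y).
have := completion_isometry Y (x - y).
by rewrite linearB -/inj xy subrr normr0 => <-.
Qed.

Lemma effort_driftE (w : effort) :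
  inj (effort_drift w) = AX w.1 + B w.2.
Proof.
rewrite /effort_drift; case: xgetP => [x _ //|nx].
by have := effortP w; rewrite inE => -[x _ xw]; case: (nx x).
Qed.

Let effort_drift_linear : linear effort_drift.
Proof.
move=> a v w; apply: completion_inj_inj.
by rewrite effort_driftE /= !linearP /= !effort_driftE scalerDr addrACA.
Qed.

HB.instance Definition _ := GRing.isLinear.Build R[i] effort (X1 * X2)%type
  *:%R effort_drift effort_drift_linear.

Definition effort_norm (w : effort) : R[i] :=
  sqrtC (pair_norm w.1 ^+ 2 + pair_norm w.2 ^+ 2
         + pair_norm (effort_drift w) ^+ 2).

Let effort_normE w : effort_norm w =
  l2norm (l2norm (pair_norm w.1) (pair_norm w.2)) (pair_norm (effort_drift w)).
Proof.
rewrite /l2norm (ger0_norm (l2norm_ge0 _ _)) sqrtCK.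
by rewrite !(ger0_norm (pair_norm_ge0 _)).
Qed.

Let effort_normD v w : effort_norm (v + w) <= effort_norm v + effort_norm w.
Proof.
rewrite !effort_normE; apply: le_trans (l2normD _ _ _ _).
apply: ler_l2norm; last first.
  rewrite !(ger0_norm (pair_norm_ge0 _)) ger0_norm ?addr_ge0 ?pair_norm_ge0//.
  by rewrite linearD; exact: pair_normD.
rewrite !(ger0_norm (l2norm_ge0 _ _)) ger0_norm ?addr_ge0 ?l2norm_ge0//.
apply: le_trans (l2normD _ _ _ _).
by apply: ler_l2norm;
  rewrite !(ger0_norm (pair_norm_ge0 _)) ger0_norm ?addr_ge0 ?pair_norm_ge0//;
  exact: pair_normD.
Qed.

Let effort_normZ a w : effort_norm (a *: w) = `|a| * effort_norm w.
Proof.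
rewrite !effort_normE [effort_drift _]linearZ /= !pair_normZ l2normM normr_id.
by rewrite l2normM normr_id.
Qed.

Let effort_norm0_eq0 w : effort_norm w = 0 -> w = 0.
Proof.
rewrite effort_normE => /l2norm_eq0[/l2norm_eq0[/pair_norm_eq0 w1]].
move=> /pair_norm_eq0 w2 _; apply: val_inj => /=.
by rewrite [LHS]surjective_pairing w1 w2.
Qed.

HB.instance Definition _ := Lmodule_isNormed.Build R[i] effort
  effort_normD effort_normZ effort_norm0_eq0.

Lemma effort_normrE (w : effort) : `|w| = effort_norm w. Proof. by []. Qed.

Lemma ler_effort_norm1 (w : effort) : pair_norm w.1 <= `|w|.
Proof.
rewrite effort_normrE effort_normE -[leLHS]ger0_norm ?pair_norm_ge0//.
apply: le_trans (ler_l2norml _ (pair_norm w.2)) _.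
by rewrite -[leLHS]ger0_norm ?l2norm_ge0// ler_l2norml.
Qed.

Lemma ler_effort_norm2 (w : effort) : pair_norm w.2 <= `|w|.
Proof.
rewrite effort_normrE effort_normE -[leLHS]ger0_norm ?pair_norm_ge0//.
apply: le_trans (ler_l2normr (pair_norm w.1) _) _.
by rewrite -[leLHS]ger0_norm ?l2norm_ge0// ler_l2norml.
Qed.

Section Flow.
Variables (x : X1 * X2) (v : dual U1 * dual U2).

Let flow_fun (w : effort) : R[i] :=
  pair_inner x w.1 + (v.1 w.2.1 + v.2 w.2.2).

Let flow_scalar : scalar flow_fun.
Proof.
move=> a y z; rewrite /flow_fun /pair_inner /= !linearP !mulrDr.
have sumE (b c d e b' c' d' e' : R[i]) :
    b + b' + (c + c') + (d + d' + (e + e')) =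
    b + c + (d + e) + (b' + c' + (d' + e')).
  by rewrite (addrACA b b') (addrACA d d') (addrACA (b + c)).
exact: sumE.
Qed.

Let flow_continuous : continuous (flow_fun : effort -> R[i]^o).
Proof.
apply: scalar_bounded_continuous; first exact: flow_scalar.
exists (`|x.1| + `|x.2| + (`|v.1| + `|v.2|)); first by rewrite !addr_ge0.
move=> w; rewrite !mulrDl /flow_fun /pair_inner.
have w1 := ler_effort_norm1 w; have w2 := ler_effort_norm2 w.
apply: (le_trans (ler_normD _ _)); apply: lerD;
  apply: (le_trans (ler_normD _ _)); apply: lerD.
- apply: (le_trans (CauchySchwarz_inner _ _)); rewrite ler_wpM2l//.
  exact: le_trans (ler_pair_norml _) w1.
- apply: (le_trans (CauchySchwarz_inner _ _)); rewrite ler_wpM2l//.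
  exact: le_trans (ler_pair_normr _) w1.
- apply: (le_trans (ler_dual_norm _ _)); rewrite ler_wpM2l ?dual_norm_ge0//.
  exact: le_trans (ler_pair_norml _) w2.
- apply: (le_trans (ler_dual_norm _ _)); rewrite ler_wpM2l ?dual_norm_ge0//.
  exact: le_trans (ler_pair_normr _) w2.
Qed.

(* (x, v) as an element of the dual of the effort space. *)
Definition flow : dual effort := Dual flow_scalar flow_continuous.

End Flow.

End Effort.
End Blocks.

Section Bond.
Variables (R : realType) (E : normedModType R[i]).

Definition bond_pairing (b1 b2 : dual E * E) : R[i] :=
  (b1.1 b2.2)^* + b2.1 b1.2.

Definition bond_orthogonal (D : set (dual E * E)) : set (dual E * E) :=
  [set b1 | forall b2, D b2 -> bond_pairing b1 b2 = 0].

Definition stokes_dirac (D : set (dual E * E)) := bond_orthogonal D = D.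

Definition graph_of (J : E -> dual E) : set (dual E * E) :=
  [set b | b.1 = J b.2].

End Bond.

Arguments flow {R X1 X2 U1 U2 L K gamma1 gamma2 Y AX B} x v.

(* Main.v *)
Require Import Defs.
From HB Require Import structures.
From mathcomp Require Import all_boot all_order all_algebra.
From mathcomp.real_closed Require Import complex.
From mathcomp Require Import all_classical all_reals all_analysis.
From mathcomp Require Import ring.

Set Implicit Arguments.
Unset Strict Implicit.
Unset Printing Implicit Defensive.

Import Order.TTheory GRing.Theory Num.Theory.
Import numFieldNormedType.Exports.

Local Open Scope classical_set_scope.
Local Open Scope ring_scope.

(** The operator A is skew-symmetric: on the kernels of gamma1 and gamma2 the
    boundary terms of Green's identity vanish. An element Xm1 of the type of
    extrapolation spaces can only exist if I - A is onto, so the resolvent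
    (I - A)^-1 is an everywhere defined linear map; skew-symmetry gives
    |z - Az|^2 = |z|^2 + |Az|^2 = |z + Az|^2, hence it is a contraction, and
    the symmetry (e1, e2) |-> (e1, -e2), which changes A into - A, makes
    I + A onto as well.

    Everything in X_{-1} is obtained by extending linear maps from dense
    subspaces ([linear_extension]). The main one is T, the extension of I - A
    to X: it is the extension along (I - A)^-1 of the embedding of X in X_{-1},
    it is injective, and A|_X is the embedding minus T
    ([extrapolated_resolvent_inverse]).

    The equation J z = A|_X z + B G z determines B, because G is onto, and
    defines it, because z is in the domain of A when G z = 0. In terms of T it
    says that B G z = T p with p = z - (I - A)^-1 (z - J z), so B is bounded
    when |p| <= C |G z|. Testing p against w + A w, with w in the domain of A,
    gives by Green's identity the boundary form of w at G z, and the choice of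
    w with w + A w = p yields |p|^2 <= C |p| |G z| since beta1 and beta2 are
    bounded for the graph norms ([defect_bounded]). This replaces the
    inversion of gamma1 and gamma2 by the open mapping theorem.

    The projection of X on its second component extends to X_{-1} since the
    flip above is an isometry for the norm of X_{-1}; as A exchanges the
    components, this extension P satisfies P A|_X (x1, x2) = A|_X (x1, 0) and
    therefore P B (u1, u2) = B (u1, 0), which locates the ranges of B1 and B2.

    Finally, injectivity of T shows that the effort space consists of the
    pairs (z, G z) with z in the domain of J, the drift being J z
    ([effort_dom_J]). Green's identity then says exactly that the map of the
    statement is skew for the bond pairing ([dirac_fun_skew]), and the graph
    of an everywhere defined skew map is its own orthogonal
    ([skew_graph_stokes_dirac]). *)

(** * Extension of linear maps by density *)

Section Density.
Variable K : numFieldType.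

Lemma dense_meets_nbhs (T : topologicalType) (S : set T) (y : T) (B : set T) :
  dense S -> nbhs y B -> exists2 s, S s & B s.
Proof.
move=> dS yB; have [|s [Bs Ss]] := dS B^° _ (open_interior B).
  by exists y.
by exists s => //; exact: nbhs_singleton.
Qed.

(** Dividing by C + 1 rather than by C avoids a case distinction on C = 0. *)
Lemma ltr_mul_div1D (C e : K) : 0 <= C -> 0 < e -> C * (e / (C + 1)) < e.
Proof.
move=> C0 e0; rewrite mulrCA gtr_pMr// ltr_pdivrMr ?ltr_wpDl//.
by rewrite mul1r ltrDl.
Qed.

Lemma normr_eq0_small (W : normedModType K) (w : W) (C : K) :
  0 <= C -> (forall e, 0 < e -> `|w| <= C * e) -> w = 0.
Proof.
move=> C0 wC; apply/eqP; rewrite -normr_le0; apply/ler_addgt0Pr => e e0.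
have d0 : 0 < e / (C + 1) by rewrite divr_gt0// ltr_wpDl.
by rewrite add0r (le_trans (wC _ d0))// ltW// ltr_mul_div1D.
Qed.

Variables (Y W : normedModType K).

Lemma linear_le_norm_continuous (f : {linear Y -> W}) (C : K) :
  0 <= C -> (forall y, `|f y| <= C * `|y|) -> continuous f.
Proof.
move=> C0 fC; apply: bounded_linear_continuous; apply/linear_boundedP.
exists C; split; first exact: ger0_real.
by move=> r Cr v; apply: (le_trans (fC v)); rewrite ler_wpM2r// ltW.
Qed.

Lemma dense_close (S : set Y) y e : dense S -> 0 < e ->
  exists2 s, S s & `|s - y| < e.
Proof.
move=> dS e0; have [s Ss ys] := dense_meets_nbhs dS (nbhsx_ballx y e e0).
by exists s => //; move: ys; rewrite -ball_normE /= distrC.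
Qed.

Lemma linear_dense_eq (f g : {linear Y -> W}) (S : set Y) (C D : K) :
  0 <= C -> 0 <= D -> (forall y, `|f y| <= C * `|y|) ->
  (forall y, `|g y| <= D * `|y|) ->
  dense S -> (forall s, S s -> f s = g s) -> f =1 g.
Proof.
move=> C0 D0 fC gD dS fg y; apply/eqP; rewrite -subr_eq0; apply/eqP.
apply: (normr_eq0_small (addr_ge0 C0 D0)) => e e0.
have [s Ss ys] := dense_close y dS e0.
have -> : f y - g y = g (s - y) - f (s - y).
  by rewrite (linearB g s) (linearB f s) (fg s Ss) opprB [RHS]addrC addrA subrK.
apply: (le_trans (ler_normB _ _)); rewrite addrC mulrDl.
by apply: lerD; [apply: (le_trans (fC _))|apply: (le_trans (gD _))];
  rewrite ler_wpM2l// ltW.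
Qed.

End Density.

Section Extension.
Variables (K : numFieldType) (V : lmodType K) (Y : normedModType K).
Variables (W : completeNormedModType K).
Variables (i : {linear V -> Y}) (f : {linear V -> W}) (C : K).
Hypotheses (C0 : 0 <= C) (idense : dense (range i)).
Hypothesis fi : forall v, `|f v| <= C * `|i v|.

(** The closure of the set of pairs (i v, f v): it turns out to be the graph of
    the extension, so that linearity and bounds are proved on it before any
    choice of values. *)
Let near_graph (y : Y) (w : W) :=
  forall e, 0 < e -> exists v, `|i v - y| < e /\ `|f v - w| < e.

Let near_graph_inj v : near_graph (i v) (f v).
Proof. by move=> e e0; exists v; rewrite !subrr !normr0. Qed.

(** The images under f of the sets v such that i v is close to y form a Cauchy
    filter, whose limit is the value sought. *)
Let near_graph_ex y : exists w, near_graph y w.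
Proof.
pose F : set_system W := f @ filter_from (nbhs y) (fun B => i @^-1` B).
have FF : ProperFilter F.
  apply: fmap_proper_filter; apply: filter_from_proper; last first.
    by move=> B yB; have [_ [v _ <-] Bv] := dense_meets_nbhs idense yB; exists v.
  apply: filter_from_filter; first by exists setT; exact: filterT.
  by move=> A B yA yB; exists (A `&` B) => //; exact: filterI.
have Fc : cauchy F.
  apply/cauchy_ballP => e e0; set d := e / (C + C + 1).
  have d0 : 0 < d by rewrite divr_gt0// ltr_wpDl// addr_ge0.
  pose A : set V := [set v | ball y d (i v)].
  have FA : F (f @` A).
    by exists (ball y d); [exact: nbhsx_ballx|move=> v Av; exists v].
  exists (f @` A, f @` A) => //= -[_ _] [/= [v vA <-] [w wA <-]].
  rewrite -ball_normE /= -linearB; apply: (le_lt_trans (fi _)).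
  apply: le_lt_trans (ltr_mul_div1D (addr_ge0 C0 C0) e0).
  rewrite mulrDl -mulrDr ler_wpM2l// linearB.
  apply: le_trans (ler_distD y _ _) _; move: vA wA.
  by rewrite /A /= -ball_normE /= (distrC y (i v)) => /ltW ? /ltW ?; exact: lerD.
exists (lim F) => e e0.
have Fl : F --> lim F by exact: cauchy_cvg.
have [B yB BA] : F (ball (lim F) e) by apply: Fl; exact: nbhsx_ballx.
have [_ [v _ <-] [Bv yv]] :=
  dense_meets_nbhs idense (filterI yB (nbhsx_ballx y e e0)).
exists v; move: yv (BA v Bv); rewrite -!ball_normE /= => yv gv.
by rewrite distrC yv distrC gv.
Qed.

Let near_graph_bounded y w : near_graph y w -> `|w| <= C * `|y|.
Proof.
move=> yw; apply/ler_addgt0Pr => e e0.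
have d0 : 0 < e / (C + 1) by rewrite divr_gt0// ltr_wpDl.
have [v [vy vw]] := yw _ d0.
rewrite -[w](subKr (f v)); apply: (le_trans (ler_normB _ _)).
have -> : C * `|y| + e = C * (`|y| + e / (C + 1)) + e / (C + 1).
  by field; rewrite gt_eqF// ltr_wpDl.
apply: lerD; last exact: ltW.
apply: (le_trans (fi v)); rewrite ler_wpM2l// -[i v](subrK y) addrC.
by apply: (le_trans (ler_normD _ _)); rewrite lerD2l ltW.
Qed.

Let near_graph_linear a x y w z : near_graph x w -> near_graph y z ->
  near_graph (a *: x + y) (a *: w + z).
Proof.
have close (T : normedModType K) (p q r s : T) e : 0 < e ->
    `|p - r| < e / (`|a| + 1) -> `|q - s| < e / (`|a| + 1) ->
    `|a *: p + q - (a *: r + s)| < e.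
  move=> e0 pr qs; rewrite opprD addrACA -scalerBr.
  apply: (le_lt_trans (ler_normD _ _)); rewrite normrZ.
  have -> : e = `|a| * (e / (`|a| + 1)) + e / (`|a| + 1).
    by field; rewrite gt_eqF// ltr_wpDl.
  by apply: ler_ltD => //; rewrite ler_wpM2l// ltW.
move=> xw yz e e0.
have d0 : 0 < e / (`|a| + 1) by rewrite divr_gt0// ltr_wpDl.
have [u [ux uw]] := xw _ d0; have [v [vy vz]] := yz _ d0.
by exists (a *: u + v); rewrite (linearP i) (linearP f); split; apply: close.
Qed.

Let near_graph_uniq y w z : near_graph y w -> near_graph y z -> w = z.
Proof.
move=> yw yz; apply/eqP; rewrite eq_sym -subr_eq0 addrC -scaleN1r -normr_le0.
apply: le_trans (near_graph_bounded (near_graph_linear (-1) yw yz)) _.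
by rewrite scaleN1r addNr normr0 mulr0.
Qed.

(** Taking for i a map with dense range, instead of the inclusion of a dense
    subspace, allows the domain of A to be described as the range of the
    resolvent. *)
Lemma linear_extension : exists g : {linear Y -> W},
  (forall v, g (i v) = f v) /\ (forall y, `|g y| <= C * `|y|).
Proof.
pose g y := sval (cid (near_graph_ex y)).
have gP y : near_graph y (g y) by rewrite /g; case: cid.
have gl : linear g.
  by move=> a x y; apply: near_graph_uniq (gP _) (near_graph_linear _ _ _).
pose h : {linear Y -> W} := HB.pack g (GRing.isLinear.Build K Y W *:%R g gl).
exists h; split=> /= [v|y].
  exact: near_graph_uniq (gP _) (near_graph_inj _).
exact: near_graph_bounded.
Qed.

End Extension.

(** A lower bound valid on a dense range passes to the limit; only injectivity
    is recorded. *)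
Lemma extension_injective (K : numFieldType) (V : lmodType K)
    (Y W : normedModType K) (i : {linear V -> Y}) (g : {linear Y -> W})
    (C : K) :
  0 <= C -> dense (range i) -> (forall v, `|i v| <= `|g (i v)|) ->
  (forall y, `|g y| <= C * `|y|) -> injective g.
Proof.
move=> C0 di ig gC x y gxy; apply/eqP; rewrite -subr_eq0; apply/eqP.
have g0 : g (x - y) = 0 by rewrite linearB gxy subrr.
have C1 : 0 <= C + 1 by rewrite addr_ge0.
apply: (normr_eq0_small C1) => e e0.
have [_ [v _ <-] vy] := dense_close (x - y) di e0.
rewrite -[x - y](subKr (i v)); apply: (le_trans (ler_normB _ _)).
rewrite mulrDl mul1r; apply: lerD; last exact: ltW.
apply: (le_trans (ig v)).
have -> : g (i v) = g (i v - (x - y)) by rewrite linearB g0 subr0.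
by apply: (le_trans (gC _)); rewrite ler_wpM2l// ltW.
Qed.

(** * Partially defined linear maps and products *)

Section LinearOn.
Variables (R : realType) (V W : lmodType R[i]) (D : set V) (f : V -> W).
Hypothesis fl : linear_on D f.

Lemma linear_onB x y : D x -> D y -> f (x - y) = f x - f y.
Proof. by move=> Dx Dy; rewrite addrC -scaleN1r fl// scaleN1r addrC. Qed.

Lemma linear_onD x y : D x -> D y -> f (x + y) = f x + f y.
Proof. by move=> Dx Dy; rewrite -[x in LHS]scale1r fl// scale1r. Qed.

Lemma linear_on0 : D 0 -> f 0 = 0.
Proof. by move=> D0; rewrite -[0 in LHS](subrr 0) linear_onB// subrr. Qed.

End LinearOn.

Lemma domB (R : realType) (V W : lmodType R[i]) (T : operator V W) x y :
  dom T x -> dom T y -> dom T (x - y).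
Proof. by move=> Tx Ty; rewrite addrC -scaleN1r; exact: dom_linear. Qed.

(** The bound given with a graph-bounded map is an arbitrary complex number;
    its modulus is a nonnegative bound. *)
Lemma graph_bounded_ge0 (R : realType) (V W Y : normedModType R[i])
    (T : operator V W) (f : graph_bounded T Y) :
  exists2 M, 0 <= M & forall x, dom T x -> `|f x| <= M * graph_norm T x.
Proof.
have [M fM] := graph_boundedP f; exists `|M| => // x Tx.
rewrite -[graph_norm T x]ger0_norm ?pair_norm_ge0// -normrM.
by rewrite [leRHS]ger0_norm ?fM// (le_trans _ (fM x Tx)).
Qed.

Section Pair.
Variables (R : realType) (V W : normedModType R[i]).
Implicit Types p q : V * W.

Lemma ler_fst_norm p : `|p.1| <= `|p|.
Proof. by rewrite prod_normE comparable_le_max ?lexx// real_comparable. Qed.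

Lemma ler_snd_norm p : `|p.2| <= `|p|.
Proof. by rewrite prod_normE comparable_le_max ?lexx ?orbT// real_comparable. Qed.

Lemma ler_norm_pair p : `|p| <= pair_norm p.
Proof.
rewrite prod_normE comparable_ge_max; last by rewrite real_comparable.
by rewrite ler_pair_norml ler_pair_normr.
Qed.

Lemma ler_pair_norm_sum p : pair_norm p <= `|p.1| + `|p.2|.
Proof.
have -> : pair_norm p = pair_norm ((p.1, 0) + (0, p.2)).
  case: p => a b; congr pair_norm.
  by rewrite -[RHS]/(a + 0, 0 + b) addr0 add0r.
apply: (le_trans (pair_normD _ _)); rewrite /pair_norm /= !normr0.
by rewrite expr0n /= addr0 add0r !sqrCK.
Qed.

(** Estimates are made in the Hilbert norm, which the inner product controls,
    whereas continuity refers to the max norm of the product. *)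
Lemma ler_pair_norm2 p : pair_norm p <= 2 * `|p|.
Proof.
apply: (le_trans (ler_pair_norm_sum p)); rewrite mulr_natl mulr2n.
by apply: lerD; [exact: ler_fst_norm|exact: ler_snd_norm].
Qed.

Lemma pair_norm0 : pair_norm (0 : V * W) = 0.
Proof. by rewrite /pair_norm /= !normr0 expr0n /= addr0 sqrtC0. Qed.

Lemma pair_normN p : pair_norm (- p) = pair_norm p.
Proof. by rewrite -scaleN1r pair_normZ normrN1 mul1r. Qed.

Lemma pair_norm_sqr p : pair_norm p ^+ 2 = `|p.1| ^+ 2 + `|p.2| ^+ 2.
Proof. by rewrite sqrtCK. Qed.

Lemma dense_setX (S : set V) (T : set W) : dense S -> dense T -> dense (S `*` T).
Proof.
move=> dS dT O [[x y] Oxy] oO.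
have [[A B] /= [xA yB] AB] : nbhs (x, y) O by exact: open_nbhs_nbhs.
have [s Ss As] := dense_meets_nbhs dS xA; have [t Tt Bt] := dense_meets_nbhs dT yB.
by exists (s, t); split => //; exact: (AB (s, t)).
Qed.

End Pair.

Section PairInner.
Variables (R : realType) (V W : hilbertType R).
Implicit Types p q r : V * W.

Lemma pair_innerC p q : pair_inner q p = (pair_inner p q)^*.
Proof. by rewrite /pair_inner rmorphD (innerC p.1) (innerC p.2). Qed.

Lemma pair_inner_norm p : pair_inner p p = pair_norm p ^+ 2.
Proof. by rewrite pair_norm_sqr -!inner_norm. Qed.

Lemma pair_innerDr p q r :
  pair_inner p (q + r) = pair_inner p q + pair_inner p r.
Proof. by rewrite /pair_inner !linearD addrACA. Qed.

Lemma pair_innerNr p q : pair_inner p (- q) = - pair_inner p q.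
Proof. by rewrite /pair_inner !linearN -opprD. Qed.

Lemma pair_innerBr p q r :
  pair_inner p (q - r) = pair_inner p q - pair_inner p r.
Proof.
by rewrite pair_innerDr pair_innerNr.
Qed.

Lemma pair_innerDl p q r :
  pair_inner (p + q) r = pair_inner p r + pair_inner q r.
Proof.
by rewrite pair_innerC pair_innerDr rmorphD (pair_innerC r p) (pair_innerC r q).
Qed.

Lemma pair_innerNl p q : pair_inner (- p) q = - pair_inner p q.
Proof.
by rewrite pair_innerC pair_innerNr rmorphN (pair_innerC q p).
Qed.

Lemma pair_normD_sqr p q : pair_inner p q + pair_inner q p = 0 ->
  pair_norm (p + q) ^+ 2 = pair_norm p ^+ 2 + pair_norm q ^+ 2.
Proof.
move=> pq; rewrite -!pair_inner_norm pair_innerDl !pair_innerDr addrACA.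
by rewrite -addrA addrA -[RHS]addr0 -pq; ring.
Qed.

End PairInner.

(** If b = (f, e) is orthogonal to the graph then, comparing with the skewness
    of D at e, f and D e take the same value at every v; the converse
    inclusion is skewness itself. *)
Lemma skew_graph_stokes_dirac (R : realType) (E : normedModType R[i])
    (D : E -> dual E) :
  (forall w v, (D w v)^* + D v w = 0) -> stokes_dirac (graph_of D).
Proof.
move=> Dskew; apply/seteqP; split=> [[f e] fe|[f e]]; last first.
  rewrite /graph_of /= => -> [g v] /= ->; exact: Dskew.
apply: dualP => v; apply: (can_inj (@conjCK _)); apply: (addIr (D v e)).
by rewrite /= Dskew; exact: (fe (D v, v)).
Qed.

(** * Projections and flip of a product *)

Section Components.
Variables (R : realType) (V W : lmodType R[i]).

Definition pair_flip (x : V * W) : V * W := (x.1, - x.2).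
Definition pair_fst0 (x : V * W) : V * W := (x.1, 0).
Definition pair_snd0 (x : V * W) : V * W := (0, x.2).

Let pair_flip_linear : linear pair_flip.
Proof.
move=> a [x1 x2] [y1 y2]; rewrite /pair_flip /= opprD -scalerN.
by rewrite -[RHS]/(_, _).
Qed.
Let pair_fst0_linear : linear pair_fst0.
Proof.
move=> a [x1 x2] [y1 y2]; rewrite /pair_fst0 /=.
by rewrite -[RHS]/(a *: x1 + y1, a *: 0 + 0) scaler0 addr0.
Qed.
Let pair_snd0_linear : linear pair_snd0.
Proof.
move=> a [x1 x2] [y1 y2]; rewrite /pair_snd0 /=.
by rewrite -[RHS]/(a *: 0 + 0, a *: x2 + y2) scaler0 addr0.
Qed.

HB.instance Definition _ := GRing.isLinear.Build R[i] (V * W)%type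
  (V * W)%type *:%R pair_flip pair_flip_linear.
HB.instance Definition _ := GRing.isLinear.Build R[i] (V * W)%type
  (V * W)%type *:%R pair_fst0 pair_fst0_linear.
HB.instance Definition _ := GRing.isLinear.Build R[i] (V * W)%type
  (V * W)%type *:%R pair_snd0 pair_snd0_linear.

Lemma pair_flipK : involutive pair_flip.
Proof. by case=> x y; rewrite /pair_flip /= opprK. Qed.

(** Writing the projection with the flip, which is an isometry of X_{-1},
    yields its continuity there. *)
Lemma pair_snd0E x : pair_snd0 x = 2^-1 *: (x - pair_flip x).
Proof.
case: x => x y; rewrite /pair_snd0 /pair_flip /=.
rewrite -[RHS]/(2^-1 *: (x - x), 2^-1 *: (y - - y)) subrr scaler0 opprK.
by rewrite -(mulr2n y) -(scaler_nat 2 y) scalerA mulVf ?scale1r// pnatr_eq0.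
Qed.

End Components.

Lemma pair_norm_flip (R : realType) (V W : normedModType R[i]) (x : V * W) :
  pair_norm (pair_flip x) = pair_norm x.
Proof. by rewrite /pair_norm /= normrN. Qed.

(** * Skew-symmetry of A and its resolvent *)

Section System.
Variables (R : realType) (X1 X2 U1 U2 : hilbertType R).
Variables (L : operator X1 X2) (K : operator X2 X1).
Variables (gamma1 : graph_bounded L U1) (gamma2 : graph_bounded K U2).
Variables (beta1 : graph_bounded L (dual U2)).
Variables (beta2 : graph_bounded K (dual U1)).
Hypothesis green : forall e1 e2, dom L e1 -> dom K e2 ->
  inner (L e1) e2 =
  inner e1 (K e2) + (beta2 e2 (gamma1 e1))^* + beta1 e1 (gamma2 e2).

Local Notation X := (X1 * X2)%type.
Local Notation J := (J_operator L K).
Local Notation A := (A_operator gamma1 gamma2).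
Local Notation G := (G_block gamma1 gamma2).

(** The pairing of the boundary output (beta2 z2, beta1 z1) of z with u. *)
Definition boundary_form (z : X) (u : U1 * U2) : R[i] :=
  beta2 z.2 u.1 + beta1 z.1 u.2.

Lemma A_domE z : dom A z <-> dom J z /\ G z = 0.
Proof.
split=> [[[Lz g1] [Kz g2]]|[[Lz Kz] [g1 g2]]]; last by [].
by split; [split|rewrite /G_block g1 g2].
Qed.

Lemma G_linear : linear_on (dom J) G.
Proof.
move=> a [x1 x2] [y1 y2] [/= Lx Kx] [/= Ly Ky].
by rewrite /G_block /= !graph_bounded_linear.
Qed.

(** Green's identity, applied to (z1, w2) and, after conjugation, to (w1, z2).
    It serves three times: for the skew-symmetry of A, for the boundedness of
    the control operators and for the skewness of the Dirac structure. *)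
Lemma green_J z w : dom J z -> dom J w ->
  pair_inner (J z) w + pair_inner z (J w) =
  boundary_form z (G w) + (boundary_form w (G z))^*.
Proof.
case: z w => [z1 z2] [w1 w2] [/= Lz Kz] [/= Lw Kw].
rewrite /pair_inner /boundary_form /= linearN.
have -> : inner (- K z2) w1 = - inner (K z2) w1.
  by rewrite -scaleN1r innerZl rmorphN rmorph1 mulN1r.
rewrite (innerC _ z2) (green Lw Kz) (green Lz Kw) !rmorphD /= conjCK.
rewrite -(innerC w1). ring.
Qed.

Lemma A_skew z w : dom A z -> dom A w ->
  pair_inner (A z) w + pair_inner z (A w) = 0.
Proof.
move=> /A_domE[Jz Gz] /A_domE[Jw Gw]; rewrite [LHS]green_J// Gz Gw.
by rewrite /boundary_form /= !linear0 addr0 conjC0 addr0.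
Qed.

Lemma A_norm_sqrD z : dom A z ->
  pair_norm (z + A z) ^+ 2 = pair_norm z ^+ 2 + pair_norm (A z) ^+ 2.
Proof. by move=> Az; rewrite pair_normD_sqr// addrC A_skew. Qed.

Lemma A_norm_sqrB z : dom A z ->
  pair_norm (z - A z) ^+ 2 = pair_norm z ^+ 2 + pair_norm (A z) ^+ 2.
Proof.
move=> Az; rewrite pair_normD_sqr ?pair_normN// pair_innerNl.
by rewrite pair_innerNr -opprD addrC A_skew// oppr0.
Qed.

(** A is block antidiagonal, hence anticommutes with the flip. *)
Lemma A_flip z : dom A z ->
  dom A (pair_flip z) /\ A (pair_flip z) = - pair_flip (A z).
Proof.
case: z => z1 z2 [[/= Lz g1] [/= Kz g2]].
have K0 := dom0 K.
have KN : dom K (- z2) by rewrite -sub0r; exact: domB.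
split.
  split; split=> //=; rewrite -sub0r.
  rewrite (linear_onB (graph_bounded_linear gamma2) K0 Kz) g2 subr0.
  exact: linear_on0 (graph_bounded_linear gamma2) K0.
rewrite /pair_flip /= -[RHS]/(- - K z2, - - L z1) !opprK.
rewrite -[- z2]sub0r (linear_onB (@operator_linear _ _ _ K) K0 Kz).
by rewrite (linear_on0 (@operator_linear _ _ _ K) K0) sub0r opprK.
Qed.

Lemma boundary_form_bounded : exists2 C, 0 <= C & forall z, dom J z ->
  forall u, `|boundary_form z u| <=
    C * sqrtC (pair_norm z ^+ 2 + pair_norm (J z) ^+ 2) * `|u|.
Proof.
have [M M0 bM] := graph_bounded_ge0 beta1.
have [N N0 bN] := graph_bounded_ge0 beta2.
exists (N + M); first exact: addr_ge0.
move=> [z1 z2] [/= Lz Kz] [u1 u2]; rewrite /boundary_form /=.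
set g := sqrtC _.
have gE : g = sqrtC (`|z1| ^+ 2 + `|z2| ^+ 2 + (`|K z2| ^+ 2 + `|L z1| ^+ 2)).
  by rewrite /g !pair_norm_sqr /= normrN.
have gL : graph_norm L z1 <= g.
  rewrite gE ler_sqrtC ?nnegrE ?addr_ge0 ?exprn_ge0//= -addrA lerD2l.
  by rewrite addrA lerDr addr_ge0 ?exprn_ge0.
have gK : graph_norm K z2 <= g.
  rewrite gE ler_sqrtC ?nnegrE ?addr_ge0 ?exprn_ge0//=.
  by apply: lerD; rewrite ?lerDr ?lerDl exprn_ge0.
rewrite !mulrDl; apply: (le_trans (ler_normD _ _)); apply: lerD.
  apply: (le_trans (ler_dual_norm _ _)).
  apply: ler_pM; rewrite ?dual_norm_ge0//; last exact: ler_fst_norm (u1, u2).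
  by apply: (le_trans (bN _ Kz)); rewrite ler_wpM2l.
apply: (le_trans (ler_dual_norm _ _)).
apply: ler_pM; rewrite ?dual_norm_ge0//; last exact: ler_snd_norm (u1, u2).
by apply: (le_trans (bM _ Lz)); rewrite ler_wpM2l.
Qed.

Variable Y : extrapolation gamma1 gamma2.
Local Notation inj := (completion_inj Y).
Local Notation res := (resolvent1 A).

(** If x were not in the range of I - A, the default value 0 of the resolvent
    would give x the norm 0 in X_{-1}; but then x = 0 = (I - A) 0. *)
Lemma resolventP x : dom A (res x) /\ res x - A (res x) = x.
Proof.
rewrite /resolvent1; case: xgetP => [z _ //|nz].
have x0 : x = 0.
  apply: (completion_norm0 Y); rewrite /resolvent1.
  by case: xgetP => [z _ /nz //|_]; exact: pair_norm0.
case: (nz 0); split; first exact: dom0.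
by rewrite (linear_on0 (@operator_linear _ _ _ A) (dom0 A)) subrr x0.
Qed.

Lemma resolventK z : dom A z -> res (z - A z) = z.
Proof.
move=> Az; have [Ar rE] := resolventP (z - A z); set r := res _ in Ar rE *.
apply/eqP; rewrite -subr_eq0; apply/eqP; apply: pair_norm_eq0.
have Ad := domB Ar Az.
have d0 : r - z - A (r - z) = 0.
  rewrite (linear_onB (@operator_linear _ _ _ A) Ar Az) opprD opprK addrACA rE.
  by rewrite addrACA subrr addNr addr0.
have := A_norm_sqrB Ad; rewrite d0 pair_norm0 expr0n /= => /esym /eqP.
by rewrite paddr_eq0 ?exprn_ge0 ?pair_norm_ge0// expf_eq0/= => /andP[/eqP].
Qed.

Let res_linear : linear res.
Proof.
move=> a x y; have [Ax xE] := resolventP x; have [Ay yE] := resolventP y.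
rewrite -[RHS]resolventK; last exact: dom_linear.
rewrite (operator_linear (o:=A)) // opprD addrACA -scalerBr.
by rewrite xE yE.
Qed.

Definition resolvent_linear : {linear X -> X} :=
  HB.pack res (GRing.isLinear.Build R[i] X X *:%R res res_linear).

(** The flip conjugates I - A to I + A. *)
Lemma resolvent_plus x : exists2 w, dom A w & w + A w = x.
Proof.
have [Ap pE] := resolventP (pair_flip x); move: (res _) Ap pE => p Ap pE.
have [Aq qE] := A_flip Ap; exists (pair_flip p) => //.
by rewrite qE -[RHS]pair_flipK -pE linearB.
Qed.

Lemma pair_norm_res x : pair_norm (res x) <= pair_norm x.
Proof.
have [Ar rE] := resolventP x.
rewrite -ler_sqr ?nnegrE ?pair_norm_ge0// -{2}rE A_norm_sqrB//.
by rewrite lerDl exprn_ge0// pair_norm_ge0.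
Qed.

Lemma normr_inj x : `|inj x| = pair_norm (res x).
Proof. exact: completion_isometry. Qed.

(** This compares (I - A)^-1 with (I + A)^-1, which differ by the Cayley
    transform of A, a unitary map. *)
Lemma normr_inj_flip x : `|inj (pair_flip x)| = `|inj x|.
Proof.
rewrite !normr_inj; have [Az zE] := resolventP x; set z := res x in Az zE *.
(* With q = (I + A)^-1 z, the vector q - A q is (I + A)^-1 x and has the same
   norm as q + A q = z. *)
have [q Aq qE] := resolvent_plus z.
have Al := @operator_linear _ _ _ A.
have AAq : dom A (A q) by rewrite -[A q](addKr q) qE addrC; exact: domB.
have Av : dom A (q - A q) by exact: domB.
have vE : q - A q + A (q - A q) = x.
  rewrite -zE -qE (linear_onB Al)// (linear_onD Al)// addrA subrK.
  by rewrite opprD addrA addrK.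
have [Af fE] := A_flip Av.
have -> : res (pair_flip x) = pair_flip (q - A q).
  by rewrite -[RHS]resolventK// fE opprK -linearD vE.
rewrite pair_norm_flip -qE; apply/eqP.
rewrite -(eqrXn2 (n := 2))// ?pair_norm_ge0//.
by rewrite A_norm_sqrB// A_norm_sqrD.
Qed.

(** * The operator A on X and its control operator *)

Lemma normr_inj_le x : `|inj x| <= 2 * `|res x|.
Proof. by rewrite normr_inj ler_pair_norm2. Qed.

Lemma inj_bounded x : `|inj x| <= 2 * `|x|.
Proof.
rewrite normr_inj; apply: le_trans (ler_pair_norm2 _); exact: pair_norm_res.
Qed.

Hypothesis ker_gamma1_dense : dense (kernel_on gamma1).
Hypothesis ker_gamma2_dense : dense (kernel_on gamma2).

Lemma dom_A_dense : dense (dom A).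
Proof. exact: (dense_setX ker_gamma1_dense ker_gamma2_dense). Qed.

(** The range of the resolvent is the domain of A. *)
Lemma range_res_dense : dense (range resolvent_linear).
Proof.
rewrite (_ : range _ = dom A); first exact: dom_A_dense.
apply/seteqP; split=> [_ [x _ <-]|z Az]; first by case: (resolventP x).
by exists (z - A z) => //; exact: resolventK.
Qed.

(** The continuous extension T of I - A to X. On X_{-1} the norm is that of the
    resolvent, which makes T an isometry up to the equivalence of the max norm
    and the Hilbert norm: this is the origin of the factor 2. *)
Lemma extrapolated_resolvent_inverse : exists T : {linear X -> Y},
  [/\ forall x, T (res x) = inj x, forall x, `|T x| <= 2 * `|x| &
      injective T].
Proof.
have [T [Ti TC]] :=
  @linear_extension _ _ _ _ resolvent_linear inj 2 (ler0n _ 2)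
    range_res_dense normr_inj_le.
exists T; split=> //.
apply: (extension_injective (C := 2) _ range_res_dense) => // v.
by rewrite Ti [leRHS]normr_inj ler_norm_pair.
Qed.

Lemma extrapolated_snd0 : exists P : {linear Y -> Y},
  (forall x, P (inj x) = inj (pair_snd0 x)) /\
  (forall y, `|P y| <= 1 * `|y|).
Proof.
have [|P [Pi P1]] := linear_extension (f := inj \o @pair_snd0 _ X1 X2) ler01
  (completion_dense (c := Y)); last by exists P.
move=> x /=; rewrite mul1r pair_snd0E linearZ normrZ linearB normfV normr_nat.
rewrite ler_pdivrMl ?ltr0n// mulr_natl mulr2n.
by apply: (le_trans (ler_normB _ _)); rewrite normr_inj_flip.
Qed.

Section Control.
Variable T : {linear X -> Y}.
Hypothesis Tres : forall x, T (res x) = inj x.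
Hypothesis TC : forall x, `|T x| <= 2 * `|x|.

Definition extended_A : {linear X -> Y} := inj \- T.

Lemma T_domA z : dom A z -> T z = inj (z - A z).
Proof. by move=> Az; rewrite -Tres resolventK. Qed.

Lemma extended_A_bounded x : `|extended_A x| <= 4 * `|x|.
Proof.
apply: (le_trans (ler_normB _ _)); have -> : 4 = 2 + 2 :> R[i] by rewrite -natrD.
by rewrite mulrDl; apply: lerD; [exact: inj_bounded|exact: TC].
Qed.

Lemma extended_A_extension : is_extension extended_A.
Proof.
split; first by apply: (linear_le_norm_continuous (C := 4)) extended_A_bounded.
move=> z Az; rewrite /extended_A /= T_domA//.
by rewrite -(linearB inj) subKr.
Qed.

(** The preimage under T of J z - A|_X z, which is the value of the control
    operator at G z; it vanishes on the domain of A. *)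
Definition defect (z : X) : X := z - res (z - J z).

Lemma T_defect z : T (defect z) = inj (J z) - extended_A z.
Proof.
rewrite /defect linearB Tres (linearB inj) /extended_A /=.
by rewrite !opprB addrCA addrA.
Qed.

(** The norm of p := defect z is |<w + A w, p>| / |p|, where w + A w = p. Since w
    is in the domain of A, the interior terms cancel and only the boundary form
    of w at G z remains. *)
Lemma defect_bounded : exists2 C, 0 <= C &
  forall z, dom J z -> pair_norm (defect z) <= C * `|G z|.
Proof.
have [C C0 bC] := boundary_form_bounded; exists C => // z Jz.
have [Ar rE] := resolventP (z - J z).
set p := defect z; have [w Aw wE] := resolvent_plus p.
have [Jw Gw] := (A_domE w).1 Aw.
have pE : pair_norm p ^+ 2 = boundary_form w (G z).
  have -> : boundary_form w (G z) =
      pair_inner (J w) z + pair_inner w (J z).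
    rewrite green_J// Gw.
    by rewrite /boundary_form /= !linear0 addr0 conjC0 addr0.
  rewrite -pair_inner_norm -{1}wE /p /defect; set r := res _ in Ar rE *.
  have -> : pair_inner w (J z) = pair_inner w z - pair_inner w (r - A r).
    by rewrite rE -pair_innerBr subKr.
  have := A_skew Aw Ar; rewrite pair_innerDl !pair_innerBr => /eqP.
  rewrite addr_eq0 => /eqP ->; rewrite -[pair_inner (A w) z]/(pair_inner (J w) z).
  ring.
have [p0|p0] := eqVneq (pair_norm p) 0; first by rewrite p0 mulr_ge0.
have pp : 0 < pair_norm p by rewrite lt_def p0 pair_norm_ge0.
rewrite -(ler_pM2l pp) -expr2.
have -> : pair_norm p ^+ 2 = `|boundary_form w (G z)|.
  by rewrite -pE ger0_norm ?exprn_ge0 ?pair_norm_ge0.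
(* The graph norm of w for A is the norm of w + A w = p. *)
apply: (le_trans (bC _ Jw _)); rewrite -[J w]/(A w) -A_norm_sqrD// wE.
by rewrite sqrCK ?pair_norm_ge0// mulrCA mulrA.
Qed.

Lemma defectD z w : dom J z -> dom J w ->
  forall a, defect (a *: z + w) = a *: defect z + defect w.
Proof.
move=> Jz Jw a; rewrite /defect (@operator_linear _ _ _ J)// opprD addrACA.
rewrite -scalerBr [res _](linearP resolvent_linear) /=.
by rewrite opprD addrACA -scalerBr.
Qed.

(** The defect is a function of the boundary value G z only, so that any right
    inverse of G may be used in the construction of the control operator. *)
Lemma defect_eq z w : dom J z -> dom J w -> G z = G w -> defect z = defect w.
Proof.
move=> Jz Jw Gzw; have [C C0 dC] := defect_bounded.
apply/eqP; rewrite eq_sym -subr_eq0 addrC -scaleN1r -defectD//.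
apply/eqP; apply: pair_norm_eq0; apply/eqP; rewrite eq_le pair_norm_ge0 andbT.
apply: (le_trans (dC _ (dom_linear _ Jz Jw))).
by rewrite G_linear// Gzw scaleN1r addNr normr0 mulr0.
Qed.

Hypothesis gamma1_onto : gamma1 @` dom L = setT.
Hypothesis gamma2_onto : gamma2 @` dom K = setT.

Lemma G_onto u : exists2 z, dom J z & G z = u.
Proof.
case: u => u1 u2.
have [z1 Lz1 g1] : (gamma1 @` dom L) u1 by rewrite gamma1_onto.
have [z2 Kz2 g2] : (gamma2 @` dom K) u2 by rewrite gamma2_onto.
by exists (z1, z2) => //; rewrite /G_block /= g1 g2.
Qed.

Lemma control_operator : exists B : {linear (U1 * U2)%type -> Y},
  (exists2 C, 0 <= C & forall u, `|B u| <= C * `|u|) /\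
  forall z, dom J z -> B (G z) = inj (J z) - extended_A z.
Proof.
pose s u := sval (cid2 (G_onto u)).
have sJ u : dom J (s u) by rewrite /s; case: cid2.
have sG u : G (s u) = u by rewrite /s; case: cid2.
pose b u := T (defect (s u)).
have bl : linear b.
  move=> a u v; rewrite /b -linearP -defectD//; congr (T _).
  apply: defect_eq => //; first exact: dom_linear.
  by rewrite G_linear// !sG.
pose B : {linear (U1 * U2)%type -> Y} :=
  HB.pack b (GRing.isLinear.Build R[i] (U1 * U2)%type Y *:%R b bl).
exists B; split=> [|z Jz]; last first.
  by rewrite -T_defect; congr (T _); apply: defect_eq; rewrite ?sG.
have [C C0 dC] := defect_bounded; exists (2 * C); first by rewrite mulr_ge0.
move=> u; apply: (le_trans (TC _)); rewrite -mulrA ler_wpM2l//.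
apply: (le_trans (ler_norm_pair _)).
by rewrite -{2}(sG u); exact: dC.
Qed.

Variable B : {linear (U1 * U2)%type -> Y}.
Hypothesis BG : forall z, dom J z -> B (G z) = inj (J z) - extended_A z.

(** Let z in the domain of J have the boundary value u. If A|_X e + B u is in X
    then A|_X (e - z) is in X, and the injectivity of T = I - A|_X puts e - z
    in the domain of A. *)
Lemma effort_dom_J : injective T -> forall e u x,
  extended_A e + B u = inj x -> [/\ dom J e, G e = u & J e = x].
Proof.
move=> Tinj e u x; have [z Jz <-] := G_onto u; rewrite BG// => exE.
have [Ad dE] := resolventP (e - z - (x - J z)).
have AXd : extended_A (e - z) = inj (x - J z).
  by rewrite (linearB inj x) -exE (linearB extended_A) addrA addrAC addrK.
have ezE : e - z = res (e - z - (x - J z)).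
  by apply: Tinj; rewrite Tres (linearB inj (e - z)) -AXd /extended_A /= subKr.
move: dE; rewrite -ezE => dE; rewrite -ezE in Ad.
have [Jd Gd] := (A_domE _).1 Ad.
have eE : e = 1 *: (e - z) + z by rewrite scale1r subrK.
have JdE : J (e - z) = x - J z.
  by rewrite -[LHS](subKr (e - z)) -[J _]/(A _) dE subKr.
rewrite eE; split; first exact: dom_linear.
  by rewrite G_linear// Gd scaler0 add0r.
by rewrite (@operator_linear _ _ _ J)// JdE scale1r subrK.
Qed.

Section Projection.
Variable P : {linear Y -> Y}.
Hypothesis Pinj : forall x, P (inj x) = inj (pair_snd0 x).
Hypothesis PC : forall y, `|P y| <= 1 * `|y|.

Lemma dom_J_fst0 z : dom J z ->
  dom J (pair_fst0 z) /\ J (pair_fst0 z) = pair_snd0 (J z).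
Proof.
case: z => z1 z2 [/= Lz Kz]; have K0 := dom0 K; split; first by split.
rewrite -[LHS]/(- K 0, L z1) /pair_snd0 /=.
by rewrite (linear_on0 (@operator_linear _ _ _ K) K0) oppr0.
Qed.

Lemma G_fst0 z : G (pair_fst0 z) = pair_fst0 (G z).
Proof.
rewrite /G_block /pair_fst0 /=.
by rewrite (linear_on0 (@graph_bounded_linear _ _ _ _ _ gamma2) (dom0 K)).
Qed.

(** A exchanges the two components of X. *)
Lemma snd0_extended_A x : P (extended_A x) = extended_A (pair_fst0 x).
Proof.
apply: (@linear_dense_eq _ _ _ (P \o extended_A)
  (extended_A \o @pair_fst0 _ X1 X2) _ 4 4 _ _ _ _ dom_A_dense) => //= {x}.
- by move=> x; apply: (le_trans (PC _)); rewrite mul1r extended_A_bounded.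
- move=> x; apply: (le_trans (extended_A_bounded _)); rewrite ler_wpM2l//.
  apply: le_trans (ler_fst_norm x); apply: (le_trans (ler_norm_pair _)).
  by apply: (le_trans (ler_pair_norm_sum _)); rewrite normr0 addr0.
move=> z Az; have [Jz Gz] := (A_domE z).1 Az.
have [Jf fE] := dom_J_fst0 Jz.
have Af : dom A (pair_fst0 z).
  by apply/A_domE; split; rewrite // G_fst0 Gz.
have AXE w : dom A w -> inj w - T w = inj (A w) := extended_A_extension.2 w.
rewrite !AXE// Pinj; congr (inj _).
by rewrite -[A z]/(J z) -fE.
Qed.

Lemma snd0_control u : P (B u) = B (pair_fst0 u).
Proof.
have [z Jz <-] := G_onto u; have [Jf fE] := dom_J_fst0 Jz.
rewrite -G_fst0 !BG// linearB Pinj snd0_extended_A.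
by rewrite fE.
Qed.

Let fixed_in_component (p : X -> X) (Q : {linear Y -> Y}) C (y : Y) :
  0 <= C -> (forall y, `|Q y| <= C * `|y|) ->
  (forall x, Q (inj x) = inj (p x)) -> Q y = y -> component p y.
Proof.
move=> C0 QC Qinj Qy; exists Q; split=> //; last by exists y.
exact: linear_le_norm_continuous QC.
Qed.

Lemma control_component2 u1 : component2 (B (u1, 0)).
Proof.
apply: (fixed_in_component ler01 PC) => //.
by rewrite snd0_control.
Qed.

Lemma control_component1 u2 : component1 (B (0, u2)).
Proof.
have P'C y : `|(idfun \- P) y| <= 2 * `|y|.
  rewrite /= mulr_natl mulr2n; apply: (le_trans (ler_normB _ _)).
  by rewrite lerD2l -[leRHS]mul1r.
apply: (fixed_in_component (ler0n _ 2) P'C) => [x|].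
  rewrite /= Pinj -(linearB inj) /pair_snd0.
  by case: x => x1 x2; rewrite -[_ - _]/(x1 - 0, x2 - x2) subr0 subrr.
by rewrite /= snd0_control /pair_fst0 /= (linear0 B) subr0.
Qed.

End Projection.
End Control.

(** * Effort space and Dirac structure *)

Section Effort.
Variable AX : {linear X -> Y}.
Variable B : {linear (U1 * U2)%type -> Y}.
Hypothesis effort_dom : forall e u x,
  AX e + B u = inj x -> [/\ dom J e, G e = u & J e = x].
Local Notation E := (effort AX B).

Lemma ler_effort_norm3 (w : E) : pair_norm (effort_drift w) <= `|w|.
Proof.
rewrite effort_normrE -[leLHS]sqrCK ?pair_norm_ge0//.
rewrite ler_sqrtC ?nnegrE ?addr_ge0 ?exprn_ge0 ?pair_norm_ge0//.
by rewrite lerDr addr_ge0 ?exprn_ge0 ?pair_norm_ge0.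
Qed.

Lemma effort_graph (w : E) :
  [/\ dom J w.1, G w.1 = w.2 & J w.1 = effort_drift w].
Proof. by apply: effort_dom; rewrite effort_driftE. Qed.

Definition dirac_fun (w : E) : dual E :=
  flow (effort_drift w) (- beta2 w.1.2, - beta1 w.1.1).

(** On the effort space seen as a graph over the domain of J, the flow map is
    the sesquilinear form of J corrected by the boundary form. *)
Lemma dirac_funE (w v : E) : dirac_fun w v =
  pair_inner (J w.1) v.1 - boundary_form w.1 (G v.1).
Proof.
have [_ _ ->] := effort_graph w; have [_ -> _] := effort_graph v.
by rewrite /boundary_form opprD.
Qed.

Lemma dirac_fun_skew w v : (dirac_fun w v)^* + dirac_fun v w = 0.
Proof.
have [Jw _ _] := effort_graph w; have [Jv _ _] := effort_graph v.
rewrite !dirac_funE rmorphB /= -pair_innerC addrACA [X in X + _]addrC.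
by rewrite (green_J Jv Jw) [X in _ + X]addrC -opprD subrr.
Qed.

(** By skewness, linearity follows from the linearity of the functionals
    [dirac_fun y]. *)
Lemma dirac_fun_linear : linear dirac_fun.
Proof.
move=> a w v; apply: dualP => y; rewrite dualDE dualZE.
have skew x : dirac_fun x y = - (dirac_fun y x)^*.
  by apply/eqP; rewrite -addr_eq0 addrC dirac_fun_skew.
rewrite !skew (linearP (dirac_fun y)) rmorphD rmorphM /=.
by rewrite opprD mulrN.
Qed.

Lemma dirac_fun_bounded : exists2 C, 0 <= C &
  forall w, `|dirac_fun w| <= C * `|w|.
Proof.
have [C C0 bC] := boundary_form_bounded.
exists (2 + C * 2); first by rewrite addr_ge0// mulr_ge0.
move=> w; apply: dual_norm_ler => [|v].
  by rewrite mulr_ge0// addr_ge0// mulr_ge0.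
have [Jw _ JE] := effort_graph w.
rewrite dirac_funE; apply: (le_trans (ler_normB _ _)).
have w1 := ler_effort_norm1 w; have w3 := ler_effort_norm3 w.
have v1 := ler_effort_norm1 v; have v2 := ler_effort_norm2 v.
rewrite -mulrA mulrDl; apply: lerD.
  rewrite JE mulr_natl mulr2n; apply: (le_trans (ler_normD _ _)).
  apply: lerD; apply: (le_trans (CauchySchwarz_inner _ _)); apply: ler_pM => //.
  - exact: le_trans (ler_pair_norml _) w3.
  - exact: le_trans (ler_pair_norml _) v1.
  - exact: le_trans (ler_pair_normr _) w3.
  - exact: le_trans (ler_pair_normr _) v1.
apply: (le_trans (bC _ Jw _)); rewrite -!mulrA ler_wpM2l// mulrA.
apply: ler_pM; rewrite ?sqrtC_ge0 ?addr_ge0 ?exprn_ge0 ?pair_norm_ge0//; last first.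
  by have [_ -> _] := effort_graph v; exact: le_trans (ler_norm_pair _) v2.
rewrite JE -[leRHS]sqrCK ?mulr_ge0// ler_sqrtC ?nnegrE; last 2 first.
- by rewrite addr_ge0 ?exprn_ge0 ?pair_norm_ge0.
- by rewrite exprn_ge0 ?mulr_ge0.
apply: (@le_trans _ _ (`|w| ^+ 2 + `|w| ^+ 2)).
  by apply: lerD; rewrite ler_sqr ?nnegrE ?pair_norm_ge0.
rewrite exprMn -natrX -[leLHS]mulr2n -[leLHS]mulr_natl ler_wpM2r ?exprn_ge0//.
by rewrite ler_nat.
Qed.

Lemma dirac_structure : exists D : {linear E -> dual E},
  [/\ continuous D,
      forall w, D w = flow (effort_drift w) (- beta2 w.1.2, - beta1 w.1.1) &
      stokes_dirac (graph_of D)].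
Proof.
pose D : {linear E -> dual E} :=
  HB.pack dirac_fun (GRing.isLinear.Build R[i] E (dual E) *:%R
    dirac_fun dirac_fun_linear).
exists D; split=> //.
  have [C C0 DC] := dirac_fun_bounded.
  exact: (linear_le_norm_continuous (f := D) C0 DC).
exact: skew_graph_stokes_dirac dirac_fun_skew.
Qed.

End Effort.

End System.

Theorem theorem3 (R : realType) (X1 X2 U1 U2 : hilbertType R)
    (L : operator X1 X2) (K : operator X2 X1)
    (closedL : closed_operator L) (densedefL : densely_defined L)
    (closedK : closed_operator K) (densedefK : densely_defined K)
    (gamma1 : graph_bounded L U1) (gamma2 : graph_bounded K U2)
    (beta1 : graph_bounded L (dual U2)) (beta2 : graph_bounded K (dual U1))
    (green : forall e1 e2, dom L e1 -> dom K e2 ->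
       inner (L e1) e2 =
       inner e1 (K e2) + (beta2 e2 (gamma1 e1))^* + beta1 e1 (gamma2 e2))
    (gamma1_onto : gamma1 @` dom L = setT)
    (gamma2_onto : gamma2 @` dom K = setT)
    (ker_gamma1_dense : dense (kernel_on gamma1))
    (ker_gamma2_dense : dense (kernel_on gamma2))
    (beta_onto :
       (dense (kernel_on gamma1 `&` kernel_on beta1) /\
        beta1 @` kernel_on gamma1 = setT) \/
       (dense (kernel_on gamma2 `&` kernel_on beta2) /\
        beta2 @` kernel_on gamma2 = setT))
    (Xm1 : extrapolation gamma1 gamma2) :
  exists AX : {linear (X1 * X2)%type -> Xm1},
    is_extension AX /\
    exists (B1 : {linear U1 -> Xm1}) (B2 : {linear U2 -> Xm1}),
      [/\ control_operators AX B1 B2,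
          forall (B1' : {linear U1 -> Xm1}) (B2' : {linear U2 -> Xm1}),
            control_operators AX B1' B2' -> B1' =1 B1 /\ B2' =1 B2 &
          exists J : {linear effort AX (B_block B1 B2) ->
                             dual (effort AX (B_block B1 B2))},
            [/\ continuous J,
                forall w, J w = flow (effort_drift w)
                                     (- beta2 w.1.2, - beta1 w.1.1) &
                stokes_dirac (graph_of J)]].
Proof.
have [T [Tres TC Tinj]] :=
  extrapolated_resolvent_inverse green Xm1 ker_gamma1_dense ker_gamma2_dense.
pose AX := extended_A T.
have AXext : is_extension AX := extended_A_extension green Tres TC.
have [B [[C C0 BC] BG]] :=
  control_operator green Tres TC gamma1_onto gamma2_onto.
have [P [Pinj PC]] := extrapolated_snd0 green Xm1.
(* B1 and B2 are the restrictions of B to the two factors of U. *)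
pose i1 (u : U1) : U1 * U2 := (u, 0); pose i2 (u : U2) : U1 * U2 := (0, u).
have i1l : linear i1.
  by move=> a u v; rewrite -[RHS]/(a *: u + v, a *: 0 + 0) scaler0 addr0.
have i2l : linear i2.
  by move=> a u v; rewrite -[RHS]/(a *: 0 + 0, a *: u + v) scaler0 addr0.
pose B1 : {linear U1 -> Xm1} :=
  B \o (HB.pack i1 (GRing.isLinear.Build R[i] U1 (U1 * U2)%type *:%R i1 i1l)
        : {linear U1 -> (U1 * U2)%type}).
pose B2 : {linear U2 -> Xm1} :=
  B \o (HB.pack i2 (GRing.isLinear.Build R[i] U2 (U1 * U2)%type *:%R i2 i2l)
        : {linear U2 -> (U1 * U2)%type}).
have BE u : B_block B1 B2 u = B u.
  case: u => u1 u2; rewrite /B_block /= -(linearD B).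
  by congr (B _); rewrite -[LHS]/(0 + u1, u2 + 0) add0r addr0.
exists AX; split=> //; exists B1, B2; split.
- split.
  + split; last first.
      by move=> _ [u _ <-]; exact: (control_component2 green ker_gamma1_dense
        ker_gamma2_dense Tres TC gamma1_onto gamma2_onto BG Pinj PC).
    apply: (linear_le_norm_continuous C0) => u; apply: (le_trans (BC _)).
    rewrite ler_wpM2l//; apply: (le_trans (ler_norm_pair _)).
    by apply: (le_trans (ler_pair_norm_sum _)); rewrite normr0 addr0.
  + split; last first.
      by move=> _ [u _ <-]; exact: (control_component1 green ker_gamma1_dense
        ker_gamma2_dense Tres TC gamma1_onto gamma2_onto BG Pinj PC).
    apply: (linear_le_norm_continuous C0) => u; apply: (le_trans (BC _)).
    rewrite ler_wpM2l//; apply: (le_trans (ler_norm_pair _)).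
    by apply: (le_trans (ler_pair_norm_sum _)); rewrite normr0 add0r.
  + by move=> z Jz; rewrite BE BG// addrC subrK.
(* The values on the range of G, which is all of U, determine B1' and B2'. *)
- move=> B1' B2' [_ _ BG'].
  have BB' u : B_block B1' B2' u = B u.
    have [z Jz <-] := G_onto gamma1_onto gamma2_onto u.
    by rewrite BG// BG'// addrC addKr.
  split=> u; [have := BB' (u, 0)|have := BB' (0, u)];
    by rewrite /B_block /= linear0 ?add0r ?addr0.
- apply: (dirac_structure green) => e u x exE.
  apply: (effort_dom_J Tres gamma1_onto gamma2_onto BG Tinj).
  by rewrite -BE; exact: exE.
Qed.
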